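(* Let $\mathcal{E}$ be a finite index set, let $c_i:\mathbb{R}^n\to\mathbb{R}$, $i\in\mathcal{E}$, be differentiable, and let $x^k\in\mathbb{R}^n$, $\Delta^k>0$. Let $\alpha\in[0,1]$ be such that the system $$\alpha c_i(x^k)+\nabla c_i(x^k)^{\mathsf T}d=0,\quad i\in\mathcal{E},$$ has a solution $d$ with $\|d\|\le\Delta^k$. Let $n^k$ be the least-norm solution to this system, and let $d^*$ be the least-norm global minimizer over $\mathbb{R}^n$ (without any constraint) of $$d\mapsto\sum_{i\in\mathcal{E}}[c_i(x^k)+\nabla c_i(x^k)^{\mathsf T}d]^2 .$$ Then $n^k$ solves $$\min_{d\in\mathbb{R}^n}\Big\{\sum_{i\in\mathcal{E}}[c_i(x^k)+\nabla c_i(x^k)^{\mathsf T}d]^2 : d=td^*,\ t\ge0,\ \|d\|\le\zeta\Delta^k\Big\}$$ with $\zeta=\|n^k\|/\Delta^k$.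
   Context: $\|\cdot\|$ is the $\ell_2$-norm. The setting is the Vardi approach for equality-constrained trust-region SQP: the linearized constraints $c_i(x^k)+\nabla c_i(x^k)^{\mathsf T}d=0$ are relaxed to $\alpha c_i(x^k)+\nabla c_i(x^k)^{\mathsf T}d=0$ for some $\alpha\in[0,1]$ chosen so that the relaxed constraints together with $\|d\|\le\Delta^k$ are feasible. *)

(* Defs.v *)
From HB Require Import structures.
From mathcomp Require Import all_boot all_order all_algebra.
From mathcomp Require Import boolp classical_sets reals topology normedtype derive.

Set Implicit Arguments.
Unset Strict Implicit.
Unset Printing Implicit Defensive.

Import Order.TTheory GRing.Theory Num.Theory.
Import numFieldNormedType.Exports.

Local Open Scope classical_set_scope.
Local Open Scope ring_scope.

(* The norm `|d| that the library puts on matrices is the sup norm, hence a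
   separate l2-norm. Differentiability does not depend on this choice, because
   the two norms are equivalent. *)
Definition l2norm (R : realType) (n : nat) (d : 'cV[R]_n) : R :=
  Num.sqrt (\sum_(j < n) d j 0 ^+ 2).

Definition gradient (R : realType) (n : nat) (f : 'cV[R]_n -> R)
    (x : 'cV[R]_n) : 'cV[R]_n :=
  \col_(j < n) 'D_(delta_mx j 0) f x.

Definition inner (R : realType) (n : nat) (u v : 'cV[R]_n) : R :=
  (u^T *m v) 0 0.

Definition argmin (R : realType) (V : Type) (S : set V) (f : V -> R) : set V :=
  [set d | S d /\ forall e, S e -> f d <= f e].

Definition relaxed_linearization (R : realType) (n : nat) (E : finType)
    (c : E -> 'cV[R]_n -> R) (x : 'cV[R]_n) (alpha : R) : set 'cV[R]_n :=
  [set d | forall i, alpha * c i x + inner (gradient (c i) x) d = 0].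

Definition sq_infeasibility (R : realType) (n : nat) (E : finType)
    (c : E -> 'cV[R]_n -> R) (x d : 'cV[R]_n) : R :=
  \sum_(i : E) (c i x + inner (gradient (c i) x) d) ^+ 2.

(* Main.v *)
(* The least-norm element of a convex set is unique, and this forces
   [nk = alpha *: dstar]: for [alpha > 0], scaling by [alpha] maps the solutions
   of the full linearization, which are then the minimizers of the sum of
   squares, onto those of the relaxed one; for [alpha = 0] both sides vanish.
   Along the ray, the residual of [t *: dstar] is [(1 - t)] times that of [0],
   so the sum of squares decreases for [t] in [[0, 1]], while the norm bound
   says exactly [t <= alpha] unless [dstar = 0]. *)

Require Import Defs.
From HB Require Import structures.
From mathcomp Require Import all_boot all_order all_algebra.
From mathcomp Require Import boolp classical_sets reals topology normedtype derive.
From mathcomp Require Import ring lra.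

Import Order.TTheory GRing.Theory Num.Theory.
Import numFieldNormedType.Exports.

Local Open Scope classical_set_scope.
Local Open Scope ring_scope.

Section L2Norm.
Context {R : realType} {n : nat}.
Implicit Types (u v : 'cV[R]_n) (a : R).

Lemma l2norm_ge0 u : 0 <= l2norm u.
Proof. exact: sqrtr_ge0. Qed.

Lemma sqr_l2norm u : l2norm u ^+ 2 = \sum_(j < n) u j 0 ^+ 2.
Proof. by rewrite sqr_sqrtr // sumr_ge0 // => j _; exact: sqr_ge0. Qed.

Lemma l2norm_le0 u : l2norm u <= 0 -> u = 0.
Proof.
move=> u_le0; have : \sum_(j < n) u j 0 ^+ 2 == 0.
  by rewrite -sqr_l2norm sqrf_eq0 eq_le u_le0 l2norm_ge0.
rewrite psumr_eq0 => [/allP u0|j _]; last exact: sqr_ge0.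
apply/colP => j; rewrite mxE; apply/eqP.
by rewrite -sqrf_eq0; apply: u0; rewrite mem_index_enum.
Qed.

Lemma l2normZ a u : 0 <= a -> l2norm (a *: u) = a * l2norm u.
Proof.
move=> a_ge0; apply: (pexpIrn (n := 2)) => //.
- by rewrite nnegrE l2norm_ge0.
- by rewrite nnegrE mulr_ge0 ?l2norm_ge0.
rewrite exprMn !sqr_l2norm mulr_sumr.
by apply: eq_bigr => j _; rewrite mxE exprMn.
Qed.

Lemma l2norm_parallelogram u v :
  l2norm (u + v) ^+ 2 + l2norm (u - v) ^+ 2 =
  2 * (l2norm u ^+ 2 + l2norm v ^+ 2).
Proof.
rewrite !sqr_l2norm -!big_split mulr_sumr.
by apply: eq_bigr => j _; rewrite !mxE /=; ring.
Qed.

(** Minimality of [u] against the midpoint gives [2 * l2norm u <= l2norm (u + v)]; the parallelogram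
    law then leaves no room for [u - v]. Convexity of [S] enters only through this midpoint. *)
Lemma argmin_l2norm_unique (S : set 'cV[R]_n) u v :
  argmin S (@l2norm R n) u -> S (2^-1 *: (u + v)) -> l2norm v <= l2norm u ->
  u = v.
Proof.
move=> [_ u_min] /u_min; rewrite l2normZ ?invr_ge0 // => mid vu.
apply/eqP; rewrite -subr_eq0; apply/eqP/l2norm_le0.
have := l2norm_parallelogram u v.
have := l2norm_ge0 u; have := l2norm_ge0 v; have := l2norm_ge0 (u - v).
have := l2norm_ge0 (u + v).
nra.
Qed.

Lemma innerD (w u v : 'cV[R]_n) : inner w (u + v) = inner w u + inner w v.
Proof. by rewrite /inner mulmxDr mxE. Qed.

Lemma innerZ (w u : 'cV[R]_n) a : inner w (a *: u) = a * inner w u.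
Proof. by rewrite /inner -scalemxAr mxE. Qed.

End L2Norm.

Section Linearization.
Context {R : realType} {n : nat} {E : finType}.
Variables (c : E -> 'cV[R]_n -> R) (x : 'cV[R]_n).
Implicit Types (d e : 'cV[R]_n) (a t : R).

(** The relaxed system is homogeneous in the pair [(a, d)]. *)
Lemma relaxed_linearizationZ t a d :
  relaxed_linearization c x a d -> relaxed_linearization c x (t * a) (t *: d).
Proof. by move=> cd i; rewrite innerZ -mulrA -mulrDr cd mulr0. Qed.

Lemma relaxed_linearization_mid a d e :
  relaxed_linearization c x a d -> relaxed_linearization c x a e ->
  relaxed_linearization c x a (2^-1 *: (d + e)).
Proof.
by move=> cd ce i; rewrite innerZ innerD; have := cd i; have := ce i; lra.
Qed.

Lemma sq_infeasibility_ge0 d : 0 <= sq_infeasibility c x d.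
Proof. by apply: sumr_ge0 => i _; exact: sqr_ge0. Qed.

Lemma sq_infeasibility_eq0 d :
  sq_infeasibility c x d = 0 <-> relaxed_linearization c x 1 d.
Proof.
split=> [/eqP|cd].
  rewrite psumr_eq0 => [/allP d0 i|i _]; last exact: sqr_ge0.
  rewrite mul1r; apply/eqP.
  by rewrite -sqrf_eq0; apply: d0; rewrite mem_index_enum.
rewrite /sq_infeasibility big1 // => i _.
by have := cd i; rewrite mul1r => ->; rewrite expr0n.
Qed.

(** The solution [e] makes the sum of squares attain its lower bound 0, so its minimizers are
    exactly its zeros. *)
Lemma argmin_sq_infeasibilityE e d :
  relaxed_linearization c x 1 e ->
  argmin setT (sq_infeasibility c x) d <-> relaxed_linearization c x 1 d.
Proof.
move=> /sq_infeasibility_eq0 e0; split=> [[_ d_min]|/sq_infeasibility_eq0 d0].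
  apply/sq_infeasibility_eq0/eqP.
  by rewrite eq_le sq_infeasibility_ge0 andbT -e0 d_min.
by split=> // e' _; rewrite d0 sq_infeasibility_ge0.
Qed.

Lemma sq_infeasibilityZ t d :
  relaxed_linearization c x 1 d ->
  sq_infeasibility c x (t *: d) = (1 - t) ^+ 2 * \sum_(i : E) c i x ^+ 2.
Proof.
move=> cd; rewrite mulr_sumr; apply: eq_bigr => i _.
have -> : inner (gradient (c i) x) (t *: d) = - (t * c i x).
  by rewrite innerZ -mulrN; congr (_ * _); have := cd i; lra.
ring.
Qed.

End Linearization.

Theorem proposition4p3p1 (R : realType) (n : nat) (E : finType)
    (c : E -> 'cV[R]_n -> R)
    (c_diff : forall (i : E) (x : 'cV[R]_n), differentiable (c i) x)
    (xk : 'cV[R]_n) (Delta : R) (Delta_gt0 : 0 < Delta)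
    (alpha : R) (alpha_ge0 : 0 <= alpha) (alpha_le1 : alpha <= 1)
    (alpha_feasible :
       exists2 d : 'cV[R]_n, relaxed_linearization c xk alpha d
                           & l2norm d <= Delta)
    (nk : 'cV[R]_n)
    (nk_least_norm :
       argmin (relaxed_linearization c xk alpha) (@l2norm R n) nk)
    (dstar : 'cV[R]_n)
    (dstar_least_norm :
       argmin (argmin setT (sq_infeasibility c xk)) (@l2norm R n) dstar) :
  let zeta := l2norm nk / Delta in
  argmin [set d : 'cV[R]_n |
            (exists2 t : R, 0 <= t & d = t *: dstar)
            /\ l2norm d <= zeta * Delta]
         (sq_infeasibility c xk) nk.
Proof.
have scaled : 0 < alpha -> relaxed_linearization c xk 1 (alpha^-1 *: nk).
  move=> alpha_gt0; rewrite -(mulVf (lt0r_neq0 alpha_gt0)).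
  exact/relaxed_linearizationZ/nk_least_norm.1.
have dstar_sol : 0 < alpha -> relaxed_linearization c xk 1 dstar.
  move=> /scaled sol; apply/(argmin_sq_infeasibilityE _ _ _ _ sol).
  exact: dstar_least_norm.1.
have nkE : nk = alpha *: dstar.
  apply: (argmin_l2norm_unique _ _ _ nk_least_norm).
    apply: relaxed_linearization_mid; first exact: nk_least_norm.1.
    have [alpha_gt0|alpha_le0] := ltP 0 alpha.
      rewrite -[X in relaxed_linearization _ _ X]mulr1.
      exact/relaxed_linearizationZ/dstar_sol.
    (* Here both [alpha *: dstar] and the constant terms of the system vanish. *)
    have -> : alpha = 0 by lra.
    by move=> i; rewrite innerZ !mul0r addr0.
  rewrite l2normZ //.
  have [alpha_gt0|alpha_le0] := ltP 0 alpha; last first.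
    by rewrite (_ : alpha = 0) ?mul0r ?l2norm_ge0 //; lra.
  (* After division by [alpha], the bound compares [dstar] with [alpha^-1 *: nk], itself a minimizer
     of the sum of squares. *)
  rewrite mulrC -ler_pdivlMr // mulrC -l2normZ ?invr_ge0 //.
  apply: dstar_least_norm.2.
  by apply/(argmin_sq_infeasibilityE _ _ _ _ (scaled alpha_gt0)); exact: scaled.
(* The choice of [zeta] makes the radius exactly [l2norm nk]. *)
move=> zeta; rewrite /zeta divfK ?lt0r_neq0 //.
split=> [|_ [[t t_ge0 ->]]]; first by split=> //; exists alpha.
rewrite nkE !l2normZ // => t_le.
(* If [dstar] is zero, the norm bound says nothing about [t], but the ray is a single point. *)
have [dstar_le0|dstar_gt0] := leP (l2norm dstar) 0.
  by rewrite (l2norm_le0 _ dstar_le0) !scaler0.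
move: t_le; rewrite ler_pM2r // => t_le.
have [alpha_gt0|alpha_le0] := ltP 0 alpha; last first.
  by rewrite (_ : t = alpha) //; lra.
rewrite !sq_infeasibilityZ; try exact: dstar_sol.
apply: ler_wpM2r; first by apply: sumr_ge0 => i _; exact: sqr_ge0.
(* Squaring preserves [1 - alpha <= 1 - t] because [t <= alpha <= 1] keeps both sides
   nonnegative. *)
by rewrite ler_sqr ?nnegrE; lra.
Qed.
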